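(* Let $n\ge1$ and let $A$ be a symmetric complex $n\times n$ matrix of rank $r$ with $1\le r\le n$. Then, for any formal power series $P(z)\in\mathbb{C}[[z_1,\dots,z_n]]$ with $o(P(z))\ge2$, $P(z)$ is $\Delta_A$-nilpotent if and only if $\Delta_A^m(P^m)=0$ for all $1\le m\le r$.
   Context: $D_i=\partial/\partial z_i$ and $\Delta_A=\sum_{i,j=1}^n a_{ij}D_iD_j$ for $A=(a_{ij})$. $o(P)$ denotes the order of $P$, i.e. the least degree of a monomial appearing in $P$ with nonzero coefficient (so $o(P)\ge 2$ means $P$ has no constant or linear terms). $P$ is $\Delta_A$-nilpotent if $\Delta_A^m(P^m)=0$ for all $m\ge1$. *)

(* Defs.v *)
From HB Require Import structures.
From mathcomp Require Import all_boot all_order all_algebra.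
From mathcomp Require Import boolp reals complex.
From mathcomp Require Import mpoly.

Set Implicit Arguments.
Unset Strict Implicit.
Unset Printing Implicit Defensive.

Import GRing.Theory.
Local Open Scope ring_scope.

(* R[[z_1, ..., z_n]]: a formal power series is its family of coefficients,    *)
(* indexed by the monomials 'X_{1..n} of the multinomials library.             *)
Definition mpseries (n : nat) (R : Type) : Type := 'X_{1..n} -> R.

Notation "{ 'mpseries' R [ n ] }" := (mpseries n R)
  (at level 0, R at level 2, n at level 2, format "{ 'mpseries'  R [ n ] }")
  : type_scope.

HB.instance Definition _ n (R : Type) := gen_eqMixin {mpseries R[n]}.
HB.instance Definition _ n (R : Type) := gen_choiceMixin {mpseries R[n]}.

Section Ring.
Variables (n : nat) (R : comNzRingType).
Implicit Types (P Q S : {mpseries R[n]}) (m : 'X_{1..n}).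

Definition mps_zero : {mpseries R[n]} := fun=> 0.
Definition mps_opp P : {mpseries R[n]} := fun m => - P m.
Definition mps_add P Q : {mpseries R[n]} := fun m => P m + Q m.
Definition mps_one : {mpseries R[n]} := fun m => (m == 0%MM)%:R.
Definition mps_scale (c : R) P : {mpseries R[n]} := fun m => c * P m.

(* The bounds on the degrees of k.1 and k.2 only make the index type finite:   *)
(* they follow from m = k.1 + k.2.                                             *)
Definition mps_mul P Q : {mpseries R[n]} := fun m =>
  \sum_(k : 'X_{1..n < (mdeg m).+1, (mdeg m).+1} | m == (k.1 + k.2)%MM)
    P k.1 * Q k.2.

Fact mps_addA : associative mps_add.
Proof. by move=> P Q S; apply: funext => m; apply: addrA. Qed.
Fact mps_addC : commutative mps_add.
Proof. by move=> P Q; apply: funext => m; apply: addrC. Qed.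
Fact mps_add0 : left_id mps_zero mps_add.
Proof. by move=> P; apply: funext => m; apply: add0r. Qed.
Fact mps_addN : left_inverse mps_zero mps_opp mps_add.
Proof. by move=> P; apply: funext => m; apply: addNr. Qed.

HB.instance Definition _ := GRing.isZmodule.Build {mpseries R[n]}
  mps_addA mps_addC mps_add0 mps_addN.

(* Polynomial truncations, used to transfer the ring axioms from {mpoly R[n]}. *)
Definition mps_trunc (k : nat) P : {mpoly R[n]} :=
  \sum_(m : 'X_{1..n < k}) P m *: 'X_[m].

Lemma mcoeff_mps_trunc k P m : (mdeg m < k)%N -> (mps_trunc k P)@_m = P m.
Proof.
move=> lt_mk; rewrite /mps_trunc raddf_sum /= (bigD1 (BMultinom lt_mk)) //=.
rewrite mcoeffZ mcoeffX eqxx mulr1 big1 ?addr0 // => k' ne_k'.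
by rewrite mcoeffZ mcoeffX (_ : (val k' == m) = false) ?mulr0 //;
   apply: contraNF ne_k'.
Qed.

Lemma mcoeffM_low (p p' q q' : {mpoly R[n]}) m :
  (forall k, (mdeg k <= mdeg m)%N -> p@_k = p'@_k) ->
  (forall k, (mdeg k <= mdeg m)%N -> q@_k = q'@_k) ->
  (p * q)@_m = (p' * q')@_m.
Proof.
move=> eqp eqq; rewrite !mcoeffM; apply: eq_bigr => k _.
by rewrite eqp ?eqq // -ltnS bmdeg.
Qed.

Lemma mps_mulE k P Q m : (mdeg m < k)%N ->
  mps_mul P Q m = (mps_trunc k P * mps_trunc k Q)@_m.
Proof.
move=> lt_mk; rewrite mcoeffM; apply: eq_bigr => i _.
by rewrite !mcoeff_mps_trunc //; apply: leq_trans (bmdeg _) lt_mk.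
Qed.

Fact mps_mulA : associative mps_mul.
Proof.
move=> P Q S; apply: funext => m; rewrite !(mps_mulE _ _ (ltnSn (mdeg m))).
set t := mps_trunc _.
have tM U V i : (mdeg i <= mdeg m)%N -> (t (mps_mul U V))@_i = (t U * t V)@_i.
  by move=> le_im; rewrite mcoeff_mps_trunc // (@mps_mulE (mdeg m).+1).
rewrite (mcoeffM_low (p' := t P) (q' := t Q * t S)) //; last exact: tM.
by rewrite mulrA; apply: mcoeffM_low => // i le_im; rewrite tM.
Qed.

Fact mps_mulC : commutative mps_mul.
Proof.
move=> P Q; apply: funext => m.
by rewrite !(mps_mulE _ _ (ltnSn (mdeg m))) mulrC.
Qed.

Fact mps_mul1 : left_id mps_one mps_mul.
Proof.
move=> P; apply: funext => m; rewrite (mps_mulE _ _ (ltnSn (mdeg m))).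
rewrite (mcoeffM_low (p' := 1) (q' := mps_trunc (mdeg m).+1 P)) //.
  by rewrite mul1r mcoeff_mps_trunc.
by move=> k le_km; rewrite mcoeff_mps_trunc // mcoeff1.
Qed.

Fact mps_mulDl : left_distributive mps_mul mps_add.
Proof.
move=> P Q S; apply: funext => m; rewrite /mps_mul /mps_add -big_split /=.
by apply: eq_bigr => k _; rewrite mulrDl.
Qed.

Fact mps_one_neq0 : mps_one != mps_zero.
Proof.
by apply/eqP => /(congr1 (@^~ 0%MM)) /eqP; rewrite /mps_one eqxx oner_eq0.
Qed.

HB.instance Definition _ := GRing.Zmodule_isComNzRing.Build {mpseries R[n]}
  mps_mulA mps_mulC mps_mul1 mps_mulDl mps_one_neq0.

Fact mps_scaleA a b P : mps_scale a (mps_scale b P) = mps_scale (a * b) P.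
Proof. by apply: funext => m; apply: mulrA. Qed.
Fact mps_scale1 : left_id 1 mps_scale.
Proof. by move=> P; apply: funext => m; apply: mul1r. Qed.
Fact mps_scaleDr : right_distributive mps_scale +%R.
Proof. by move=> a P Q; apply: funext => m; apply: mulrDr. Qed.
Fact mps_scaleDl P : {morph mps_scale^~ P : a b / a + b}.
Proof. by move=> a b; apply: funext => m; apply: mulrDl. Qed.

HB.instance Definition _ := GRing.Zmodule_isLmodule.Build R {mpseries R[n]}
  mps_scaleA mps_scale1 mps_scaleDr mps_scaleDl.

(* None stands for +oo, the order of the zero series.                          *)
Definition mps_order P : option nat :=
  match pselect (exists d, `[< exists m, P m != 0 /\ mdeg m = d >]) with
  | left ex_d => Some (ex_minn ex_d)
  | right _ => None
  end.

Definition order_geq (o : option nat) (k : nat) : bool :=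
  if o is Some d then (k <= d)%N else true.

Lemma order_geqP P k :
  order_geq (mps_order P) k <-> forall m, P m != 0 -> (k <= mdeg m)%N.
Proof.
rewrite /mps_order; case: pselect => [ex_d | noP] /=; last first.
  by split=> // _ m Pm; case: noP; exists (mdeg m); apply/asboolP; exists m.
case: ex_minnP => d /asboolP[m0 [Pm0 dm0]] d_min; split=> [le_kd m Pm|].
  by apply: leq_trans le_kd (d_min _ _); apply/asboolP; exists m.
by move/(_ m0 Pm0); rewrite dm0.
Qed.

(* The coefficient of z^m in the partial derivative D_i P is                   *)
(* (m_i + 1) times the coefficient of z^m z_i in P.                            *)
Definition mps_deriv (i : 'I_n) P : {mpseries R[n]} :=
  fun m => P (m + U_(i))%MM *+ (m i).+1.

Definition laplacian (A : 'M[R]_n) P : {mpseries R[n]} :=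
  \sum_i \sum_j A i j *: mps_deriv i (mps_deriv j P).

Definition laplacian_nilpotent (A : 'M[R]_n) P : Prop :=
  forall m : nat, (1 <= m)%N -> iter m (laplacian A) (P ^+ m) = 0.

End Ring.

(* Main.v *)
Require Import Defs.
From HB Require Import structures.
From mathcomp Require Import all_boot all_order all_algebra.
From mathcomp Require Import boolp reals complex.
From mathcomp Require Import mpoly.
From mathcomp Require Import perm ring.

Import GRing.Theory.
Local Open Scope ring_scope.
Local Open Scope complex_scope.

Set Implicit Arguments.
Unset Strict Implicit.
Unset Printing Implicit Defensive.

(* Write H = A Hess(P). The solution q of the Hamilton-Jacobi equation
   dq/dt = <grad q, grad q>_A with q(0) = P links Delta^m P^m to Tr H^m.
   On the one hand, along D = d/dt - 2 <grad q, grad _>_A the matrix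
   A Hess(q) satisfies the Riccati equation D X = 2 X^2, hence
   D Tr X^m = 2 m Tr X^(m+1), so Delta q = Tr X vanishes modulo t^k iff
   Tr H^m = 0 for 1 <= m <= k. On the other hand, as long as Delta q vanishes,
   (m+1) d/dt q^m = Delta q^(m+1), so the first possibly nonzero coefficient
   of Delta q is a nonzero rational multiple of Delta^(k+1) P^(k+1); hence
   Delta q vanishes modulo t^k iff Delta^m P^m = 0 for 1 <= m <= k. The traces
   of the powers of H are those of an r x r matrix, which is nilpotent as soon
   as the first r of them vanish. *)

Definition derivation (T : comNzRingType) (D : T -> T) : Prop :=
  {morph D : x y / x + y} /\ forall x y, D (x * y) = D x * y + x * D y.

(** * Derivations on matrices, determinants and traces *)

Section Derivation.
Variables (T : comNzRingType) (D : T -> T).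
Hypothesis derD : derivation D.

Lemma der0 : D 0 = 0.
Proof. by apply: (addrI (D 0)); rewrite -derD.1 !addr0. Qed.

Lemma der1 : D 1 = 0.
Proof. by apply: (addrI (D 1)); rewrite -[in RHS](mul1r 1) derD.2 !mul1r mulr1 addr0. Qed.

Lemma derN x : D (- x) = - D x.
Proof. by apply: (addrI (D x)); rewrite -derD.1 !subrr der0. Qed.

Lemma derB x y : D (x - y) = D x - D y.
Proof. by rewrite derD.1 derN. Qed.

Lemma derMn x k : D (x *+ k) = D x *+ k.
Proof. by elim: k => [|k IHk]; rewrite ?mulr0n ?der0 // !mulrS derD.1 IHk. Qed.

Lemma der_sum I r (p : pred I) (F : I -> T) :
  D (\sum_(i <- r | p i) F i) = \sum_(i <- r | p i) D (F i).
Proof. exact: (big_morph D derD.1 der0). Qed.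

Lemma derX x m : D (x ^+ m.+1) = x ^+ m * D x *+ m.+1.
Proof.
elim: m => [|m IHm]; first by rewrite expr1 mul1r.
by rewrite exprSr derD.2 IHm exprSr [in RHS]mulrS; ring.
Qed.

Lemma der_prod (I : finType) (F : I -> T) :
  D (\prod_i F i) = \sum_k \prod_i (if i == k then D (F i) else F i).
Proof.
elim: (index_enum I) (index_enum_uniq I) => [|i r IHr] /=.
  by rewrite !big_nil der1.
case/andP=> i_r uniq_r; rewrite !big_cons derD.2 IHr // eqxx.
congr (_ + _).
  congr (_ * _); apply: eq_big_seq => j r_j.
  by case: eqP => // eq_ji; rewrite -eq_ji r_j in i_r.
rewrite mulr_sumr; apply: eq_big_seq => k r_k; rewrite big_cons.
by case: eqP => // eq_ik; rewrite eq_ik r_k in i_r.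
Qed.

(** Jacobi's formula: by the product rule the derivative is the sum of the determinants in which a
    single row is differentiated, and each of these is expanded along that row. *)
Lemma der_det m (M : 'M[T]_m) : D (\det M) = \sum_i \sum_j D (M i j) * cofactor M i j.
Proof.
pose N k : 'M[T]_m := \matrix_(i, j) if i == k then D (M i j) else M i j.
transitivity (\sum_k \det (N k)).
  rewrite exchange_big der_sum; apply: eq_bigr => s _ /=; rewrite -mulr_sumr.
  have -> : \sum_k \prod_i N k i (s i) = D (\prod_i M i (s i)).
    by rewrite der_prod; apply: eq_bigr => k _; apply: eq_bigr => i _; rewrite mxE.
  by case: (odd_perm s); rewrite ?expr0 ?mul1r // expr1 !mulN1r derN.
apply: eq_bigr => k _; rewrite (expand_det_row _ k); apply: eq_bigr => j _.
rewrite mxE eqxx; congr (_ * (_ * \det _)); apply/matrixP => u v; rewrite !mxE.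
by rewrite eq_sym (negPf (neq_lift k u)).
Qed.

Lemma der_mulmx m n p (M : 'M[T]_(m, n)) (N : 'M_(n, p)) :
  map_mx D (M *m N) = map_mx D M *m N + M *m map_mx D N.
Proof.
apply/matrixP => i j; rewrite !mxE der_sum -big_split /=.
by apply: eq_bigr => k _; rewrite derD.2 !mxE.
Qed.

Lemma der_trace m (M : 'M[T]_m) : D (\tr M) = \tr (map_mx D M).
Proof. by rewrite der_sum; apply: eq_bigr => i _; rewrite mxE. Qed.

(** [M] need not commute with its derivative, so the product rule yields a sum of [k.+1] products
    with the derivative in every position; cyclicity of the trace makes their traces equal. *)
Lemma der_traceX m (M : 'M[T]_m) k :
  D (\tr (M ^+ k.+1)) = \tr (M ^+ k * map_mx D M) *+ k.+1.
Proof.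
rewrite der_trace.
suff tr_mulX (N : 'M[T]_m) :
    \tr (N *m map_mx D (M ^+ k.+1))
    = \tr (N *m (\sum_(i < k.+1) M ^+ i * map_mx D M * M ^+ (k - i))).
  rewrite -[map_mx D _]mul1mx tr_mulX mul1mx raddf_sum /= -[in RHS](card_ord k.+1).
  rewrite -sumr_const; apply: eq_bigr => i _.
  by rewrite mxtrace_mulC [(_ *m _)]mulrA -exprD subnK // -ltnS.
congr (\tr (N *m _)); elim: k {N} => [|k IHk].
  by rewrite big_ord1 expr1 subn0 expr0 mul1r mulr1.
rewrite exprSr [in LHS]/GRing.mul /= der_mulmx IHk [RHS]big_ord_recr /= subnn mulr1.
congr (_ + _); rewrite [_ *m _]mulr_suml; apply: eq_bigr => i _.
by rewrite -mulrA -exprSr subSn // -ltnS.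
Qed.

End Derivation.

(** * The Laplacian, the gradient form and the Riccati equation for the Hessian *)

Section SecondOrder.
Variables (T : comNzRingType) (n : nat) (a : 'M[T]_n) (d : 'I_n -> T -> T).

Definition lap (f : T) := \sum_i \sum_j a i j * d i (d j f).
Definition grad_form (f g : T) := \sum_i \sum_j a i j * (d i f * d j g).
Definition hess (f : T) : 'M[T]_n := \matrix_(i, j) d i (d j f).

Lemma trace_hess f : a^T = a -> \tr (a *m hess f) = lap f.
Proof.
move=> aT; rewrite /mxtrace /lap exchange_big; apply: eq_bigr => i _ /=.
by rewrite mxE; apply: eq_bigr => j _; rewrite !mxE -[in LHS]aT mxE.
Qed.

Hypotheses (aT : a^T = a) (d_der : forall i, derivation (d i)).

Lemma grad_formC f g : grad_form f g = grad_form g f.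
Proof.
rewrite /grad_form exchange_big; apply: eq_bigr => i _; apply: eq_bigr => j _.
by rewrite -[in LHS]aT mxE [d j f * _]mulrC.
Qed.

Lemma grad_form_derivation f : derivation (grad_form f).
Proof.
split=> g h; rewrite /grad_form.
  rewrite -big_split; apply: eq_bigr => i _; rewrite -big_split.
  by apply: eq_bigr => j _; rewrite (d_der j).1 mulrDr mulrDr.
rewrite mulr_suml mulr_sumr -big_split; apply: eq_bigr => i _ /=.
rewrite mulr_suml mulr_sumr -big_split; apply: eq_bigr => j _ /=.
by rewrite (d_der j).2; ring.
Qed.

Lemma lapD : {morph lap : f g / f + g}.
Proof.
move=> f g; rewrite /lap -big_split; apply: eq_bigr => i _ /=.
rewrite -big_split; apply: eq_bigr => j _ /=.
by rewrite (d_der j).1 (d_der i).1 mulrDr.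
Qed.

Lemma lap0 : lap 0 = 0.
Proof. by apply: (addrI (lap 0)); rewrite -lapD !addr0. Qed.

Lemma lapM f g : lap (f * g) = lap f * g + f * lap g + grad_form f g *+ 2.
Proof.
rewrite mulr2n {2}grad_formC /lap /grad_form.
rewrite mulr_suml mulr_sumr -!big_split; apply: eq_bigr => i _ /=.
rewrite mulr_suml mulr_sumr -!big_split; apply: eq_bigr => j _ /=.
by rewrite (d_der j).2 (d_der i).1 !(d_der i).2; ring.
Qed.

(** One gradient term is kept unexpanded: for a Hamilton-Jacobi solution [q], [grad_form q (q ^+ m)]
    is the time derivative of [q ^+ m], so the right-hand side becomes that derivative once [lap q]
    vanishes. *)
Lemma lapX f m : lap (f ^+ m.+1)
  = (f ^+ m * lap f + grad_form f (f ^+ m)) *+ m.+1.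
Proof.
have grad_der := grad_form_derivation f.
elim: m => [|m IHm]; first by rewrite expr1 expr0 (der1 grad_der) addr0 mul1r.
(* Both sides equal m(m+1) f^m <grad f, grad f>. *)
have shift : f * grad_form f (f ^+ m) *+ m.+1 = grad_form f (f ^+ m.+1) *+ m.
  case: m {IHm} => [|m]; first by rewrite expr0 (der1 grad_der) mulr0.
  by rewrite !(derX grad_der) mulrnAr mulrA -exprS mulrnAC.
rewrite [in LHS]exprS lapM IHm mulrnAr mulrDr [in LHS]mulrnDl shift.
move: (grad_form _ _) (lap f) => G l.
by rewrite !mulrS mulr0n exprS; ring.
Qed.

Hypothesis d_const : forall i j k, d i (a j k) = 0.
Hypothesis d_comm : forall i j x, d i (d j x) = d j (d i x).

Lemma d_grad_form (D : T -> T) f g : derivation D ->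
    (forall i j, D (a i j) = 0) -> (forall i x, D (d i x) = d i (D x)) ->
  D (grad_form f g) = grad_form (D f) g + grad_form f (D g).
Proof.
move=> derD D_const D_comm; rewrite /grad_form (der_sum derD) -big_split.
apply: eq_bigr => i _ /=; rewrite (der_sum derD) -big_split.
apply: eq_bigr => j _ /=; rewrite !derD.2 D_const !D_comm; ring.
Qed.

Variables (dt : T -> T) (q : T).
Hypothesis dt_der : derivation dt.
Hypothesis dt_const : forall i j, dt (a i j) = 0.
Hypothesis dt_comm : forall i x, dt (d i x) = d i (dt x).

(** The derivative along the characteristics of the Hamilton-Jacobi equation, called D in the
    overview. *)
Definition material (f : T) := dt f - grad_form q f *+ 2.

Lemma material_derivation : derivation material.
Proof.
have [gD gM] := grad_form_derivation q.
by split=> x y; rewrite /material (dt_der.1, dt_der.2) (gD, gM); ring.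
Qed.

Let error := dt q - grad_form q q.

(** Differentiate [error] along i and j. The second derivative of [grad_form q q] gives twice a
    transport term, absorbed by [material], and twice the form of the gradients of [d i q] and
    [d j q], which is the Riccati term. *)
Lemma material_hess : map_mx material (hess q)
  = hess error + (hess q *m a *m hess q) *+ 2.
Proof.
apply/matrixP => i j; rewrite mulr2n !mxE.
have -> : \sum_k (hess q *m a) i k * hess q k j = grad_form (d i q) (d j q).
  rewrite /grad_form exchange_big; apply: eq_bigr => k _ /=; rewrite mxE mulr_suml.
  by apply: eq_bigr => l _; rewrite !mxE (d_comm l); ring.
have d_grad k f g := d_grad_form f g (d_der k) (d_const k) (fun l => d_comm k l).
rewrite /material /error dt_comm dt_comm !(derB (d_der _)) !d_grad.
rewrite (d_der i).1 !d_grad !(grad_formC _ q) (grad_formC (d i q)); ring.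
Qed.

Lemma material_trace_hess m (H := a *m hess q) : material (\tr (H ^+ m.+1))
  = (\tr (H ^+ m *m (a *m hess error)) + \tr (H ^+ m.+2) *+ 2) *+ m.+1.
Proof.
rewrite (der_traceX material_derivation); congr (_ *+ _).
have material_const : map_mx material a = 0.
  apply/matrixP => i j; rewrite !mxE /material dt_const.
  rewrite /grad_form big1 ?mul0rn ?subr0 // => k _.
  by rewrite big1 // => l _; rewrite d_const !mulr0.
rewrite (der_mulmx material_derivation) material_hess material_const mul0mx add0r.
rewrite -(raddfMn (@mxtrace _ _)) -mxtraceD /=; congr (\tr _).
have -> : H ^+ m.+2 = H ^+ m *m (a *m (hess q *m a *m hess q)).
  by rewrite !exprSr -mulrA -!mulmxA [a *m (_ *m _)]mulmxA.
by rewrite !mulr2n -!mulmxDr.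
Qed.

End SecondOrder.

(** * Vanishing modulo a power of t *)

Section Vanish.
Variable S : comNzRingType.

Definition vanish (k : nat) (F : {poly S}) : Prop := forall i, (i < k)%N -> F`_i = 0.

Lemma vanishW j k F : (j <= k)%N -> vanish k F -> vanish j F.
Proof. by move=> le_jk F0 i /leq_trans /(_ le_jk); apply: F0. Qed.

Lemma vanish0 k : vanish k 0.
Proof. by move=> i _; rewrite coef0. Qed.

Lemma vanishD k F G : vanish k F -> vanish k G -> vanish k (F + G).
Proof. by move=> F0 G0 i lt_ik; rewrite coefD F0 ?G0 ?addr0. Qed.

Lemma vanishN k F : vanish k F -> vanish k (- F).
Proof. by move=> F0 i lt_ik; rewrite coefN F0 ?oppr0. Qed.

Lemma vanishMl k F G : vanish k G -> vanish k (F * G).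
Proof.
move=> G0 i lt_ik; rewrite coefM big1 // => j _.
by rewrite G0 ?mulr0 // (leq_ltn_trans (leq_subr _ _)).
Qed.

Lemma vanishMn k F m : vanish k F -> vanish k (F *+ m).
Proof. by move=> F0; rewrite -mulr_natl; apply: vanishMl. Qed.

Lemma vanish_sum k I r (p : pred I) (F : I -> {poly S}) :
  (forall i, p i -> vanish k (F i)) -> vanish k (\sum_(i <- r | p i) F i).
Proof.
by move=> F0; apply: big_ind => //; [apply: vanish0 | apply: vanishD].
Qed.

Lemma vanish_deriv k F : vanish k.+1 F -> vanish k F^`().
Proof. by move=> F0 i lt_ik; rewrite coef_deriv F0 ?mul0rn. Qed.

Lemma vanish_trace k n (M N : 'M[{poly S}]_n) :
  (forall i j, vanish k (N i j)) -> vanish k (\tr (M *m N)).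
Proof.
move=> N0; apply: vanish_sum => i _; rewrite mxE.
by apply: vanish_sum => j _; apply: vanishMl.
Qed.

End Vanish.

(** * Extending spatial derivations to polynomials in t *)

Section CoefficientwiseDerivation.
Variables (S : comNzRingType) (D : S -> S).
Hypothesis derD : derivation D.

Lemma coef_map_der F i : (map_poly D F)`_i = D F`_i.
Proof. exact: coef_map_id0 (der0 derD). Qed.

Lemma map_poly_derivation : derivation (map_poly D).
Proof.
split=> F G; apply/polyP => i; rewrite !(coefD, coef_map_der) ?derD.1 //.
rewrite !coefM (der_sum derD) -big_split; apply: eq_bigr => j _ /=.
by rewrite derD.2 !coef_map_der.
Qed.

Lemma deriv_map_der F : (map_poly D F)^`() = map_poly D F^`().
Proof.
by apply/polyP => i; rewrite !(coef_deriv, coef_map_der) (derMn derD).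
Qed.

Lemma vanish_map_der k F : vanish k F -> vanish k (map_poly D F).
Proof. by move=> F0 i lt_ik; rewrite coef_map_der F0 ?(der0 derD). Qed.

End CoefficientwiseDerivation.

Lemma deriv_derivation (S : comNzRingType) : derivation (@deriv S).
Proof. by split=> F G; rewrite ?derivD ?derivM. Qed.

(** * The truncated Hamilton-Jacobi flow *)

(* The time t is the indeterminate of {poly S}; power series in t are truncated
   at an order K. *)
Section Flow.
Variables (S : comNzRingType) (n : nat) (a : 'M[S]_n) (d : 'I_n -> S -> S).
Hypotheses (aT : a^T = a) (d_der : forall i, derivation (d i)).
Hypothesis d_const : forall i j k, d i (a j k) = 0.
Hypothesis d_comm : forall i j x, d i (d j x) = d j (d i x).
Hypothesis natr_reg : forall k (x : S), x *+ k.+1 = 0 -> x = 0.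
Hypothesis natr_div : forall k (x : S), exists y, y *+ k.+1 = x.

Let at_ : 'M[{poly S}]_n := map_mx polyC a.
Let dt_ (i : 'I_n) : {poly S} -> {poly S} := map_poly (d i).
Local Notation lapt := (lap at_ dt_).
Local Notation gradt := (grad_form at_ dt_).

Let atT : at_^T = at_.
Proof. by rewrite /at_ map_trmx aT. Qed.

Let dt_der i : derivation (dt_ i).
Proof. exact: map_poly_derivation. Qed.

Let dt_const i j k : dt_ i (at_ j k) = 0.
Proof.
apply/polyP => l; rewrite coef_map_der // mxE coefC coef0.
by case: eqP; rewrite ?d_const ?(der0 (d_der i)).
Qed.

Let dt_comm i j F : dt_ i (dt_ j F) = dt_ j (dt_ i F).
Proof. by apply/polyP => l; rewrite !coef_map_der. Qed.

Let deriv_const i j : (at_ i j)^`() = 0.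
Proof. by rewrite mxE derivC. Qed.

Let deriv_comm i F : (dt_ i F)^`() = dt_ i F^`().
Proof. exact: deriv_map_der. Qed.

Lemma coef_lap F i : (lapt F)`_i = lap a d F`_i.
Proof.
rewrite coef_sum; apply: eq_bigr => j _; rewrite coef_sum; apply: eq_bigr => l _.
by rewrite mxE coefCM !coef_map_der.
Qed.

Lemma coef_iter_lap m F i : (iter m lapt F)`_i = iter m (lap a d) F`_i.
Proof. by elim: m => //= m IHm; rewrite coef_lap IHm. Qed.

Lemma vanish_iter_lap m k (F : {poly S}) : vanish k F -> vanish k (iter m lapt F).
Proof.
move=> F0 i lt_ik; rewrite coef_iter_lap F0 //.
by elim: m => //= m ->; rewrite (lap0 a d_der).
Qed.

Lemma deriv_lap F : (lapt F)^`() = lapt F^`().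
Proof.
have derS := deriv_derivation S.
rewrite (der_sum derS); apply: eq_bigr => i _; rewrite (der_sum derS).
by apply: eq_bigr => j _; rewrite derivM deriv_const mul0r add0r !deriv_comm.
Qed.

Lemma lapMn F k : lapt (F *+ k) = lapt F *+ k.
Proof.
by elim: k => [|k IHk]; rewrite ?mulr0n ?(lap0 _ dt_der) // !mulrS (lapD _ dt_der) IHk.
Qed.

Lemma vanish_grad k (F G : {poly S}) : vanish k G -> vanish k (gradt F G).
Proof.
move=> G0; apply: vanish_sum => i _; apply: vanish_sum => j _.
by do 2!apply: vanishMl; apply: vanish_map_der.
Qed.

Lemma vanish_reg k (F : {poly S}) m : vanish k (F *+ m.+1) -> vanish k F.
Proof. by move=> F0 i lt_ik; apply: (@natr_reg m); rewrite -coefMn F0. Qed.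

(** The solution is built one power of t at a time: a correction c t^(K+1) changes the time
    derivative by (K+1) c t^K, and the quadratic term only from order K+1 on. *)
Lemma hamilton_jacobi P K : exists2 q : {poly S}, q`_0 = P &
  vanish K (q^`() - gradt q q).
Proof.
elim: K => [|K [q q0 qK]]; first by exists P%:P; rewrite ?coefC.
(* [c] is chosen so that (K+1) c cancels the coefficient of t^K in the defect. *)
have [c cK] := natr_div K (- (q^`() - gradt q q)`_K).
pose w := c *: 'X^(K.+1).
have wE i : w`_i = if i == K.+1 then c else 0.
  by rewrite coefZ coefXn; case: eqP; rewrite ?mulr1 ?mulr0.
have w0 : vanish K.+1 w by move=> i lt_iK; rewrite wE ltn_eqF.
exists (q + w); first by rewrite coefD q0 wE addr0.
have -> : (q + w)^`() - gradt (q + w) (q + w) =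
    q^`() - gradt q q + w^`() + - (gradt (q + w) w + gradt q w).
  rewrite derivD (grad_form_derivation at_ dt_der (q + w)).1.
  rewrite (grad_formC dt_ atT (q + w) q) (grad_form_derivation at_ dt_der q).1.
  by rewrite -!addrA; congr (_ + _); ring.
apply: vanishD; last first.
  by apply/vanishN/vanishD; apply: vanish_grad.
move=> i; rewrite ltnS leq_eqVlt coefD coef_deriv wE eqSS => /predU1P[->|lt_iK].
  by rewrite eqxx cK subrr.
by rewrite qK // ltn_eqF // mul0rn addr0.
Qed.

(** * Two criteria for the vanishing of Delta q to a given order *)

Section Solution.
Variables (K : nat) (q : {poly S}).
Hypothesis qK : vanish K (q^`() - gradt q q).

Let H := at_ *m hess dt_ q.
Let P := q`_0.

(** In the exact identity for [material], the transport term vanishes to order k along with the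
    trace, since spatial derivatives act coefficientwise; the term coming from the defect vanishes
    to order K. *)
Lemma deriv_trace_hess m k : (k <= K)%N -> vanish k (\tr (H ^+ m.+1)) ->
  vanish k ((\tr (H ^+ m.+1))^`() - \tr (H ^+ m.+2) *+ (2 * m.+1)).
Proof.
move=> le_kK trk.
have := material_trace_hess atT dt_der dt_const dt_comm q
  (deriv_derivation S) deriv_const deriv_comm m.
rewrite /material -/H mulrnDl -mulrnA => eq_tr.
have -> : (\tr (H ^+ m.+1))^`() - \tr (H ^+ m.+2) *+ (2 * m.+1) =
   gradt q (\tr (H ^+ m.+1)) *+ 2
   + \tr (H ^+ m *m (at_ *m hess dt_ (q^`() - gradt q q))) *+ m.+1.
  by apply/eqP; rewrite subr_eq -addrA -eq_tr addrC subrK.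
apply: vanishD; first exact/vanishMn/vanish_grad.
apply/vanishMn; rewrite mulmxA; apply: vanish_trace => i j; rewrite mxE.
by do 2!apply: vanish_map_der => //; apply: vanishW qK.
Qed.

Lemma coef0_trace_hess m : (\tr (H ^+ m))`_0 = \tr ((a *m hess d P) ^+ m).
Proof.
have map0M (M N : 'M[{poly S}]_n) : map_mx (coefp 0) (M *m N)
    = map_mx (coefp 0) M *m map_mx (coefp 0) N.
  exact: map_mxM.
have H0 : map_mx (coefp 0) H = a *m hess d P.
  rewrite map0M; congr (_ *m _); apply/matrixP => i j; rewrite !mxE /coefp ?coefC //.
  by rewrite !coef_map_der.
rewrite -H0; have -> : map_mx (coefp 0) H ^+ m = map_mx (coefp 0) (H ^+ m).
  elim: m => [|m IHm]; last by rewrite !exprS IHm; apply/esym/map0M.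
  by rewrite !expr0; apply/matrixP => i j; rewrite !mxE /coefp coefMn coef1.
by rewrite coef_sum; apply: eq_bigr => i _; rewrite mxE.
Qed.

Lemma vanish_lap_trace k : (k <= K)%N ->
  vanish k (lapt q) <->
  (forall m, (1 <= m <= k)%N -> \tr ((a *m hess d P) ^+ m) = 0).
Proof.
move=> le_kK; have tr1 : \tr (H ^+ 1) = lapt q by rewrite expr1 trace_hess.
split=> [lap_k [|m] // /andP[_ lt_mk]|u0].
  (* Each passage to the next power of [H] costs one time derivative, hence one order; for m < k the
     constant coefficient is still reached. *)
  suff trm : vanish (k - m) (\tr (H ^+ m.+1)).
    by rewrite -coef0_trace_hess trm // subn_gt0.
  elim: m lt_mk => [|m IHm] lt_mk; first by rewrite tr1 subn0.
  have trm := IHm (ltnW lt_mk).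
  have le_mk : (k - m.+1 < k - m)%N by rewrite ltn_sub2l // ltnW.
  apply: (@vanish_reg _ _ (2 * m.+1).-1); rewrite prednK //.
  rewrite -[_ *+ _](subKr (\tr (H ^+ m.+1))^`()); apply: vanishD.
    by apply: vanish_deriv; apply: vanishW trm.
  apply/vanishN/deriv_trace_hess; last exact: vanishW (ltnW le_mk) trm.
  by rewrite (leq_trans (leq_subr _ _)).
case: k le_kK u0 => // k le_kK u0; rewrite -tr1.
(* Conversely, the initial values are integrated in t: order j+1 for one power comes from order j
   for the same power and the next one, so that j + m stays bounded. *)
have tr_ind j m : (j + m <= k)%N -> vanish j.+1 (\tr (H ^+ m.+1)).
  elim: j m => [|j IHj] m le_jmk.
    by case=> // _; rewrite coef0_trace_hess u0 // ltnS.
  have tr_j := IHj m (ltnW le_jmk); have tr_jS := IHj m.+1.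
  rewrite addnS -addSn in tr_jS; move/(_ le_jmk): tr_jS => tr_jS.
  have trd : vanish j.+1 (\tr (H ^+ m.+1))^`().
    rewrite -[_^`()](subrK (\tr (H ^+ m.+2) *+ (2 * m.+1))).
    apply: vanishD; last exact: vanishMn.
    apply: deriv_trace_hess => //; apply: leq_trans le_kK.
    by rewrite ltnS (leq_trans (leq_addr m j)) // ltnW.
  case=> [|i] lt_ij; first exact: tr_j.
  by apply: (@natr_reg i); rewrite -coef_deriv trd.
by apply: tr_ind; rewrite addn0.
Qed.

(** With G_j = Delta^(j+1) q^(j+1), one has (j+2) dG_j/dt = G_(j+1) modulo t^k. Trading each order
    in t for one index j takes the coefficient of t^k in G_0 = Delta q to the value of G_k at t = 0,
    up to nonzero integer factors. *)
Lemma coef_lap_power k : (k <= K)%N -> vanish k (lapt q) ->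
  (lapt q)`_k = 0 <-> iter k.+1 (lap a d) (P ^+ k.+1) = 0.
Proof.
move=> le_kK lap_k; pose G j := iter j.+1 lapt (q ^+ j.+1).
have derG j : vanish k ((G j)^`() *+ j.+2 - G j.+1).
  have -> : (G j)^`() *+ j.+2 - G j.+1 =
      iter j.+1 lapt ((q ^+ j.+1)^`() *+ j.+2 - lapt (q ^+ j.+2)).
    have iter_der m F : (iter m lapt F)^`() = iter m lapt F^`().
      by elim: m => //= m IHm; rewrite deriv_lap IHm.
    have iter_lin m F F' c :
        iter m lapt (F *+ c - F') = iter m lapt F *+ c - iter m lapt F'.
      elim: m => //= m ->; rewrite (lapD _ dt_der) lapMn; congr (_ + _).
      apply: (addrI (lapt (iter m lapt F'))).
      by rewrite -(lapD _ dt_der) !subrr (lap0 _ dt_der).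
    by rewrite iter_lin iter_der -iterSr.
  apply: vanish_iter_lap.
  have grad_der := grad_form_derivation at_ dt_der q.
  (* What remains is a multiple of [lapt q] and a multiple of the Hamilton-Jacobi defect, and both
     vanish to order k. *)
  rewrite (lapX atT dt_der) -mulrnBl; apply: vanishMn.
  rewrite opprD addrCA; apply: vanishD; first exact/vanishN/vanishMl.
  rewrite (derX (deriv_derivation S)) (derX grad_der) -mulrnBl -mulrBr.
  by apply/vanishMn/vanishMl/(vanishW le_kK).
have shift i j : (i <= k)%N -> (G j)`_i = 0 <-> (G (j + i)%N)`_0 = 0.
  elim: i j => [|i IHi] j lt_ik; first by rewrite addn0.
  rewrite addnS -addSn -IHi; last exact: ltnW.
  have := derG j i lt_ik; rewrite coefB coefMn coef_deriv => /subr0_eq <-.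
  split=> [->|]; first by rewrite !mul0rn.
  by move/natr_reg/natr_reg.
have -> : lapt q = G 0 by rewrite /G /= expr1.
rewrite (shift k) // add0n coef_iter_lap; suff -> : (q ^+ k.+1)`_0 = P ^+ k.+1 by [].
by elim: k.+1 => [|m IHm]; rewrite ?coef1 // !exprS coef0M IHm.
Qed.

Lemma vanish_lap_power k : (k <= K)%N ->
  vanish k (lapt q) <->
  (forall m, (1 <= m <= k)%N -> iter m (lap a d) (P ^+ m) = 0).
Proof.
elim: k => [|k IHk] le_kK; first by split=> // _ [].
have [lap_v v_lap] := IHk (ltnW le_kK); split=> [lap_k m|v0].
  rewrite [(m <= k.+1)%N]leq_eqVlt; case/andP=> m_gt0 /predU1P[->|lt_mk].
    apply/coef_lap_power; [exact: ltnW | exact: vanishW lap_k | exact: lap_k].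
  by apply: lap_v; rewrite ?m_gt0 //; apply: vanishW lap_k.
have lap_k : vanish k (lapt q).
  by apply: v_lap => m /andP[m_gt0 le_mk]; rewrite v0 // m_gt0 leqW.
move=> i; rewrite ltnS leq_eqVlt => /predU1P[->|]; last exact: lap_k.
by apply/coef_lap_power => //; [exact: ltnW | apply: v0; rewrite leqnn].
Qed.

End Solution.

Theorem lap_power_trace P k :
  (forall m, (1 <= m <= k)%N -> iter m (lap a d) (P ^+ m) = 0) <->
  (forall m, (1 <= m <= k)%N -> \tr ((a *m hess d P) ^+ m) = 0).
Proof.
have [q q0 qk] := hamilton_jacobi P k.
by rewrite -q0 -(vanish_lap_power qk) // -(vanish_lap_trace qk).
Qed.

End Flow.

Lemma deriv_char_poly (S : comNzRingType) n (N : 'M[S]_n) :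
  (char_poly N)^`() = \tr (\adj (char_poly_mx N)).
Proof.
rewrite /char_poly (der_det (deriv_derivation S)); apply: eq_bigr => i _; rewrite mxE.
rewrite (bigD1 i) //= big1 => [|j ne_ji].
  by rewrite !mxE eqxx mulr1n derivB derivX derivC subr0 mul1r addr0.
by rewrite !mxE eq_sym (negPf ne_ji) mulr0n sub0r derivN derivC oppr0 mul0r.
Qed.

(** * Nilpotency from vanishing traces, by way of the adjugate *)

Section TraceNilpotent.
Variables (S : comNzRingType) (r : nat) (N : 'M[S]_r).
Local Notation p := (char_poly N).
(** The matrix coefficients of the adjugate of 'X - [N], viewed as a polynomial in 'X. *)
Let B k : 'M[S]_r := map_mx (coefp k) (\adj (char_poly_mx N)).

(** Compare coefficients in adj('X - N) ('X - N) = p. The factor 'X covers i = 0 as well, where no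
    coefficient of index i - 1 exists. *)
Lemma coef_adj_mul i (u v : 'I_r) :
  ('X * \adj (char_poly_mx N) u v)`_i - (B i *m N) u v = p`_i *+ (u == v).
Proof.
have /matrixP /(_ u v) := mul_adj_mx (char_poly_mx N).
rewrite {2}/char_poly_mx mulmxBr mul_mx_scalar !mxE => /(congr1 (coefp i)).
rewrite /coefp coefB coefMn coef_sum => <-; congr (_ - _).
by apply: eq_bigr => l _; rewrite !mxE coefMC.
Qed.

(* Both sides solve the recursion X k = X k.+1 *m N + (p`_k.+1)%:M and vanish
   for large k. *)
Lemma coef_adj_char_poly_mx k :
  B k = \sum_(j < r.+1) p`_(k.+1 + j)%N *: N ^+ j.
Proof.
pose C k := \sum_(j < r.+1) p`_(k.+1 + j)%N *: N ^+ j.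
have sz_p i : (r < i)%N -> p`_i = 0.
  by move=> lt_ri; rewrite nth_default // size_char_poly.
have stepB i : B i = B i.+1 *m N + (p`_i.+1)%:M.
  apply/matrixP => u v; have := coef_adj_mul i.+1 u v.
  rewrite coefXM /= => /eqP; rewrite subr_eq => /eqP eqB.
  by rewrite [LHS]mxE [RHS]mxE /coefp eqB addrC [_%:M _ _]mxE.
have stepC i : C i = C i.+1 *m N + (p`_i.+1)%:M.
  rewrite /C big_ord_recl addn0 expr0 scale_scalar_mx mulr1 addrC; congr (_ + _).
  rewrite mulmx_suml [RHS]big_ord_recr /= sz_p ?scale0r ?mul0mx ?addr0; last first.
    by rewrite addSn ltnS ltnW // ltnS leq_addl.
  by apply: eq_bigr => j _; rewrite -scalemxAl exprSr /bump addnS.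
pose m := \max_u \max_v size (\adj (char_poly_mx N) u v).
have B0 i : (m <= i)%N -> B i = 0.
  move=> le_mi; apply/matrixP => u v; rewrite mxE [RHS]mxE /coefp nth_default //.
  apply: leq_trans le_mi; apply: leq_trans (leq_bigmax u).
  exact: (leq_bigmax (F := fun v => size (\adj (char_poly_mx N) u v)) v).
have C0 i : (r <= i)%N -> C i = 0.
  move=> le_ri; rewrite /C big1 // => j _.
  by rewrite sz_p ?scale0r // addSn ltnS (leq_trans le_ri) // leq_addr.
(* Descending induction from an index where both families vanish; once the truncated subtraction
   reaches 0, the index no longer moves. *)
have BC i : B (maxn m r - i)%N = C (maxn m r - i)%N.
  elim: i => [|i IHi].
    by rewrite subn0 B0 ?C0 // (leq_maxl, leq_maxr).
  have [le_i|lt_i] := leqP (maxn m r) i.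
    by move: le_i IHi; rewrite subnS -subn_eq0 => /eqP ->.
  by rewrite stepB stepC -subSn // subSS IHi.
have [/ltnW le_k|lt_k] := ltnP k (maxn m r); first by rewrite -/(C k) -(subKn le_k).
by rewrite -/(C k) B0 ?C0 // (leq_trans _ lt_k) // (leq_maxl, leq_maxr).
Qed.

Hypothesis natr_reg : forall k (x : S), x *+ k.+1 = 0 -> x = 0.
Hypothesis trace0 : forall m, (1 <= m <= r)%N -> \tr (N ^+ m) = 0.

Lemma trace_coef_adj k : \tr (B k) = p`_k.+1 *+ r.
Proof.
rewrite coef_adj_char_poly_mx raddf_sum big_ord_recl big1 ?addr0 /=.
  by rewrite addn0 expr0 mxtraceZ mxtrace1 mulr_natr.
by move=> j _; rewrite mxtraceZ trace0 ?mulr0 //= ltn_ord.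
Qed.

(* Newton's identities, read off p^`() = \tr (\adj ('X - N)). *)
Lemma char_poly_trace0 k : (k < r)%N -> p`_k = 0.
Proof.
case: k => [|k] lt_kr.
  (* The derivative of [p] does not see its constant term, which is read off the trace of the
     relation - B_0 N = p_0 instead. In the sum for B_0 N the power r+1 would escape the hypothesis,
     but its coefficient lies beyond the degree of [p]. *)
  have trB0 : \tr (B 0 *m N) = 0.
    rewrite coef_adj_char_poly_mx mulmx_suml raddf_sum big1 // => j _.
    rewrite /= -scalemxAl mxtraceZ.
    have [->|ne_jr] := eqVneq (j : nat) r.
      by rewrite nth_default ?mul0r // size_char_poly.
    rewrite -[N ^+ j *m N]/(N ^+ j * N) -exprSr trace0 ?mulr0 //=.
    by rewrite ltn_neqAle ne_jr -ltnS ltn_ord.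
  apply: (natr_reg (k := r.-1)); rewrite prednK //.
  apply: oppr_inj; rewrite oppr0 -[RHS]trB0 -mxtrace_scalar -raddfN.
  congr (\tr _); apply/matrixP => u v; have := coef_adj_mul 0 u v.
  by rewrite coefXM sub0r => eqB; rewrite !mxE -eqB opprK !mxE.
have := trace_coef_adj k.
have -> : \tr (B k) = (\tr (\adj (char_poly_mx N)))`_k.
  by rewrite coef_sum; apply: eq_bigr => i _; rewrite mxE.
rewrite -deriv_char_poly coef_deriv.
(* The two values r p_(k+1) and (k+1) p_(k+1) of the same trace leave (r-k-1) p_(k+1) = 0, a
   positive multiple. *)
have -> : p`_k.+1 *+ r = p`_k.+1 *+ k.+1 + p`_k.+1 *+ (r - k.+1).
  by rewrite -mulrnDr subnKC // ltnW.
move=> /eqP; rewrite addrC -subr_eq subrr eq_sym => /eqP p0.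
by apply: (natr_reg (k := (r - k.+1).-1)); rewrite prednK ?subn_gt0.
Qed.

(** Only the leading coefficient of [p] survives, so B_0 = N^(r-1), while B_0 N = - p_0 = 0. *)
Lemma trace_nilpotent : N ^+ r = 0.
Proof.
(* For r = 0 the power is the identity, which equals 0 as a matrix without entries. *)
have [r0|r_gt0] := posnP r.
  by apply/matrixP => [[u lt_u]]; exfalso; move: lt_u; rewrite r0.
have <- : B 0 *m N = N ^+ r.
  rewrite coef_adj_char_poly_mx.
  have lt_r : (r.-1 < r.+1)%N by rewrite prednK // ltnW.
  rewrite (bigD1 (Ordinal lt_r)) //= big1 => [|j ne_jr].
    have /monicP := char_poly_monic N; rewrite /lead_coef size_char_poly add1n prednK //.
    have -> : N ^+ r = N ^+ r.-1.+1 by rewrite prednK.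
    by move=> ->; rewrite addr0 scale1r exprSr.
  rewrite add1n; have [lt_jr|le_rj] := ltnP j.+1 r.
    by rewrite char_poly_trace0 ?scale0r.
  rewrite nth_default ?scale0r // size_char_poly ltn_neqAle le_rj andbT.
  by apply: contraNneq ne_jr => eq_r; apply/eqP/val_inj/esym; have := congr1 predn eq_r.
apply/matrixP => u v; have := coef_adj_mul 0 u v.
rewrite coefXM sub0r char_poly_trace0 // mul0rn => /eqP.
by rewrite oppr_eq0 => /eqP ->; rewrite mxE.
Qed.

End TraceNilpotent.

(** * The nilpotency criterion for a factored coefficient matrix *)

Section LowRank.
Variables (S : comNzRingType) (n r : nat) (d : 'I_n -> S -> S).
Variables (U : 'M[S]_(n, r)) (V : 'M[S]_(r, n)).
Local Notation a := (U *m V).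
Hypotheses (aT : a^T = a) (d_der : forall i, derivation (d i)).
Hypothesis d_const : forall i j k, d i (a j k) = 0.
Hypothesis d_comm : forall i j x, d i (d j x) = d j (d i x).
Hypothesis natr_reg : forall k (x : S), x *+ k.+1 = 0 -> x = 0.
Hypothesis natr_div : forall k (x : S), exists y, y *+ k.+1 = x.

Lemma lap_nilpotent_low_rank P :
  (forall m, (1 <= m)%N -> iter m (lap a d) (P ^+ m) = 0) <->
  (forall m, (1 <= m <= r)%N -> iter m (lap a d) (P ^+ m) = 0).
Proof.
split=> [lapP m /andP[m_gt0 _]|lapP m m_gt0]; first exact: lapP.
have lap_trace := lap_power_trace aT d_der d_const d_comm natr_reg natr_div P.
apply: (lap_trace m).2; last by rewrite m_gt0 leqnn.
(* Moving [U] cyclically to the other end turns the traces of the n x n powers into those of an r x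
   r matrix. *)
pose N := V *m hess d P *m U.
have trE k : \tr ((a *m hess d P) ^+ k.+1) = \tr (N ^+ k.+1).
  have -> : (a *m hess d P) ^+ k.+1 = U *m (N ^+ k *m (V *m hess d P)).
    elim: k => [|k IHk]; first by rewrite expr1 expr0 mul1mx mulmxA.
    rewrite exprS IHk [N ^+ k.+1]exprS -[N * _]/(N *m _) -[LHS]/(_ *m _).
    by rewrite [in RHS]/N !mulmxA.
  by rewrite mxtrace_mulC exprSr /N [in RHS]/GRing.mul /= !mulmxA.
have nilN : N ^+ r = 0.
  apply: trace_nilpotent natr_reg _ => -[|k] // le_kr.
  by rewrite -trE ((lap_trace r).1 lapP).
case=> [|k] // le_km; rewrite trE.
have [le_rk|lt_kr] := leqP r k.+1.
  by rewrite -(subnKC le_rk) exprD nilN mul0r raddf0.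
by rewrite -trE ((lap_trace r).1 lapP) //= ltnW.
Qed.

End LowRank.

(** * Power series as an instance of the abstract calculus *)

Section PowerSeries.
Variables (n : nat) (R : comNzRingType).
Implicit Types P Q : {mpseries R[n]}.

Fact mps_scaleAl (c : R) P Q : c *: (P * Q) = (c *: P) * Q.
Proof.
apply: funext => m; rewrite -[LHS]/(c * mps_mul P Q m) /mps_mul mulr_sumr.
by apply: eq_bigr => k _; rewrite mulrA.
Qed.

HB.instance Definition _ :=
  GRing.Lmodule_isLalgebra.Build R {mpseries R[n]} mps_scaleAl.

Lemma mps_deriv_derivation (i : 'I_n) : derivation (@mps_deriv n R i).
Proof.
split=> P Q; apply: funext => m; first exact: mulrnDl.
(* The derivative at [m] reads coefficients of degree [(mdeg m).+1], and truncation keeps the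
   degrees strictly below its bound. *)
pose t := @mps_trunc n R (mdeg m).+2.
have mdegU k : mdeg (k + U_(i))%MM = (mdeg k).+1 by rewrite mdegD mdeg1 addn1.
have derivt X k : (mdeg k <= mdeg m)%N -> ((t X)^`M(i))@_k = (t (mps_deriv i X))@_k.
  move=> le_km; rewrite mcoeff_deriv !mcoeff_mps_trunc ?mdegU ?ltnS //.
  exact: leqW.
transitivity ((t P * t Q)^`M(i))@_m.
  rewrite mcoeff_deriv /mps_deriv; congr (_ *+ _).
  by apply: mps_mulE; rewrite mdegU.
rewrite mderivM mcoeffD; congr (_ + _).
  transitivity (t (mps_deriv i P) * t Q)@_m.
    by apply: mcoeffM_low => // k; apply: derivt.
  by symmetry; apply: mps_mulE; rewrite ltnS.
transitivity (t P * t (mps_deriv i Q))@_m.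
  by apply: mcoeffM_low => // k; apply: derivt.
by symmetry; apply: mps_mulE; rewrite ltnS.
Qed.

Lemma mps_derivC (i j : 'I_n) P :
  mps_deriv i (mps_deriv j P) = mps_deriv j (mps_deriv i P).
Proof.
apply: funext => m; rewrite /mps_deriv -!mulrnA -!addmA [(U_(i) + _)%MM]addmC.
rewrite !mnmDE !mnm1E eq_sym; case: eqVneq => [->|_] //.
by rewrite !addn0 mulnC.
Qed.

Lemma mps_deriv_alg (i : 'I_n) (c : R) : mps_deriv i c%:A = 0.
Proof.
apply: funext => m; rewrite /mps_deriv.
rewrite /GRing.scale /= /mps_scale /GRing.one /= /mps_one -mdeg_eq0.
by rewrite mdegD mdeg1 addn1 mulr0 mul0rn.
Qed.

Lemma laplacianE (A : 'M[R]_n) :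
  laplacian A = lap (map_mx (in_alg {mpseries R[n]}) A) (@mps_deriv n R).
Proof.
apply: funext => P; apply: eq_bigr => i _; apply: eq_bigr => j _.
by rewrite mxE mulr_algl.
Qed.

End PowerSeries.

(** * The criterion over the complex numbers, by rank factorization *)

Theorem proposition3p6 (R : realType) (n r : nat) (A : 'M[R[i]]_n)
    (n_ge1 : (1 <= n)%N) (A_sym : A^T = A) (A_rank : \rank A = r)
    (r_bounds : (1 <= r <= n)%N)
    (P : {mpseries R[i][n]}) (P_order : order_geq (mps_order P) 2) :
  laplacian_nilpotent A P <->
  (forall m : nat, (1 <= m <= r)%N -> iter m (laplacian A) (P ^+ m) = 0).
Proof.
pose T := {mpseries R[i][n]}; subst r.
(* A full-rank factorization has inner dimension [\rank A], which is the size of the small matrix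
   whose traces are tested. *)
have factA : map_mx (in_alg T) (col_base A) *m map_mx (in_alg T) (row_base A)
    = map_mx (in_alg T) A.
  by rewrite -map_mxM mulmx_base.
rewrite /laplacian_nilpotent laplacianE -factA.
have mulrnE k (F : T) m : (F *+ k) m = F m *+ k.
  by elim: k => [|k IHk]; rewrite ?mulr0n // !mulrS -IHk.
apply: lap_nilpotent_low_rank.
- by rewrite factA map_trmx A_sym.
- exact: mps_deriv_derivation.
- by move=> i j k; rewrite factA mxE; apply: mps_deriv_alg.
- exact: mps_derivC.
- move=> k F Fk; apply: funext => m; have /(congr1 (@^~ m)) := Fk; rewrite mulrnE.
  by move=> /eqP; rewrite -mulr_natr mulf_eq0 Num.Theory.pnatr_eq0 orbF => /eqP.
- move=> k F; exists (fun m => F m / k.+1%:R); apply: funext => m.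
  by rewrite mulrnE -[LHS]mulr_natr divfK // Num.Theory.pnatr_eq0.
Qed.
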